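(* Let $L$ be a complete and completely distributive lattice, $G$ a group, and $\mu$ an $L$-subgroup of $G$. Let $\eta$ be a pronormal $L$-subgroup of $\mu$ satisfying $\mathrm{tip}(\eta)=\mathrm{tip}(\mu)$, and let $N(\eta)$ denote the normalizer of $\eta$ in $\mu$. Then $N(\eta)$ is a pronormal $L$-subgroup of $\mu$.
   Context: $L$ has least element $0$ and greatest element $1$. An $L$-subset of $G$ is a function $G \to L$; inclusion $\eta\subseteq\mu$ means $\eta(x)\le\mu(x)$ for all $x\in G$; unions and intersections of $L$-subsets are pointwise joins and meets. The tip of an $L$-subset $\mu$ is $\mathrm{tip}(\mu)=\bigvee_{x\in G}\mu(x)$. An $L$-subgroup of $G$ is a function $\mu: G\to L$ with $\mu(xy)\ge\mu(x)\wedge\mu(y)$ and $\mu(x^{-1})=\mu(x)$ for all $x,y\in G$; $L(G)$ is the set of these. For $\mu\in L(G)$, $L(\mu)$ denotes the set of $\eta\in L(G)$ with $\eta\subseteq\mu$ (the $L$-subgroups of $\mu$). For an $L$-subset $\theta$ of $G$, $\langle\theta\rangle$ is the smallest $L$-subgroup of $G$ containing $\theta$, and $\langle\eta,\nu\rangle=\langle\eta\cup\nu\rangle$. $L$-points: for $a\in L$, $x\in G$, the $L$-point $a_x$ is the $L$-subset with value $a$ at $x$ and $0$ elsewhere; $a_x\in\mu$ means $\mu(x)\ge a$. Conjugate: for $\eta\in L(\mu)$ and $a_z\in\mu$, $\eta^{a_z}$ is the $L$-subgroup of $\mu$ given by $\eta^{a_z}(x)=a\wedge\eta(zxz^{-1})$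 for all $x\in G$. Pronormal: $\eta\in L(\mu)$ is a pronormal $L$-subgroup of $\mu$ if for every $L$-point $a_x\in\mu$ there exists an $L$-point $b_y\in\langle\eta,\eta^{a_x}\rangle$ such that $\eta^{b_y}=\eta^{a_x}$. Cosets and normalizer: for $\eta\in L(\mu)$ and $a_x\in\mu$, the cosets are $(a_x\circ\eta)(z)=a\wedge\eta(x^{-1}z)$ and $(\eta\circ a_x)(z)=a\wedge\eta(zx^{-1})$ for $z\in G$. The normalizer of $\eta$ in $\mu$ is the $L$-subgroup $N(\eta)=\bigcup\{a_x\in\mu : a_x\circ\eta=\eta\circ a_x\}$ of $\mu$, the union being over $L$-points of $\mu$. *)

(* Defs.v *)
From mathcomp Require Import all_boot all_order monoid.
From mathcomp Require Import all_classical.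

Set Implicit Arguments.
Unset Strict Implicit.
Unset Printing Implicit Defensive.

Import Order.TTheory.

Local Open Scope classical_set_scope.
Local Open Scope order_scope.
Local Open Scope group_scope.

Section CompleteLattices.
Context (d : Order.disp_t) (L : tbLatticeType d).

Definition complete_lattice : Prop :=
  forall A : set L, supremums A !=set0 /\ infimums A !=set0.

(* The first argument of supremum (infimum) is its value on the empty set, so
   in a complete lattice these are the join and the meet of every A. *)
Definition lsup (A : set L) : L := supremum \bot A.
Definition linf (A : set L) : L := infimum \top A.

Definition completely_distributive : Prop :=
  forall (I : Type) (J : I -> set L),
    linf (range (fun i => lsup (J i))) =
    lsup [set linf (range f) | f in [set f : I -> L | forall i, J i (f i)]].

Lemma lsupP (A : set L) : complete_lattice -> supremums A (lsup A).
Proof.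
move=> cL; rewrite /lsup /supremum; case: ifPn => [/eqP ->|_].
  by split=> [y []|y _]; exact: le0x.
by have [[x Ax] _] := cL A; case: xgetP => [y _ //|/(_ x)].
Qed.

Lemma linfP (A : set L) : complete_lattice -> infimums A (linf A).
Proof.
move=> cL; rewrite /linf /infimum; case: ifPn => [/eqP ->|_].
  by split=> [y []|y _]; exact: lex1.
by have [_ [x Ax]] := cL A; case: xgetP => [y _ //|/(_ x)].
Qed.

End CompleteLattices.

Arguments complete_lattice {d} L.
Arguments completely_distributive {d} L.

Section LSubsets.
Context (d : Order.disp_t) (L : tbLatticeType d) (G : groupType).
Implicit Types (mu eta nu theta : G -> L) (a b : L) (x y z : G).

Definition lsubset eta mu : Prop := forall x, eta x <= mu x.

Definition lunion eta nu : G -> L := fun x => eta x `|` nu x.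

Definition lbigunion (F : set (G -> L)) : G -> L :=
  fun z => lsup [set theta z | theta in F].

Definition lbigcap (F : set (G -> L)) : G -> L :=
  fun z => linf [set theta z | theta in F].

Definition tip mu : L := lsup (range mu).

Definition lsubgroup mu : Prop :=
  (forall x y, mu x `&` mu y <= mu (x * y)) /\ (forall x, mu x^-1 = mu x).

Definition lsubgroup_of mu eta : Prop := lsubgroup eta /\ lsubset eta mu.

Definition lgen theta : G -> L :=
  lbigcap [set nu | lsubgroup nu /\ lsubset theta nu].

Definition lpoint a x : G -> L := fun z => if z == x then a else \bot.

Definition lpoint_in a x mu : Prop := a <= mu x.

(* The exponent of eta^{a_z} is passed as the pair (a, z), not as the L-subset
   lpoint a z. *)
Definition lconj eta a z : G -> L := fun x => a `&` eta (z * x * z^-1).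

Definition pronormal mu eta : Prop :=
  lsubgroup_of mu eta /\
  forall a x, lpoint_in a x mu ->
    exists b y, lpoint_in b y (lgen (lunion eta (lconj eta a x))) /\
                lconj eta b y = lconj eta a x.

Definition left_coset a x eta : G -> L := fun z => a `&` eta (x^-1 * z).
Definition right_coset eta a x : G -> L := fun z => a `&` eta (z * x^-1).

Definition normalizer mu eta : G -> L :=
  lbigunion [set theta | exists a x,
    [/\ theta = lpoint a x, lpoint_in a x mu
      & left_coset a x eta = right_coset eta a x]].

Lemma lpoint_inP a x mu : lpoint_in a x mu <-> lsubset (lpoint a x) mu.
Proof.
rewrite /lpoint_in /lsubset /lpoint; split=> [le_a z|/(_ x)]; last by rewrite eqxx.
by case: eqP => [->|_] //; exact: le0x.
Qed.

Lemma lgen_least theta : complete_lattice L ->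
  [/\ lsubgroup (lgen theta), lsubset theta (lgen theta)
    & forall nu, lsubgroup nu -> lsubset theta nu -> lsubset (lgen theta) nu].
Proof.
move=> cL.
have lb nu z : lsubgroup nu -> lsubset theta nu -> lgen theta z <= nu z.
  by move=> gnu snu; apply: (linfP _ cL).1; exists nu.
have glb c z : (forall nu, lsubgroup nu -> lsubset theta nu -> c <= nu z) ->
    c <= lgen theta z.
  by move=> hc; apply: (linfP _ cL).2 => _ [nu [gnu snu] <-]; exact: hc.
split=> [|z|nu gnu snu z]; last exact: lb.
- split=> [x y|x].
    apply: glb => nu gnu snu; apply: le_trans (gnu.1 x y).
    by apply: leI2; exact: lb.
  apply/eqP; rewrite eq_le; apply/andP; split; apply: glb => nu gnu snu.
    by rewrite -(gnu.2 x); exact: lb.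
  by rewrite (gnu.2 x); exact: lb.
- by apply: glb => nu _; exact.
Qed.

End LSubsets.

(* Main.v *)
(** A point [a_x] of [mu] lies in [N(eta)] iff [eta^{a_x}] is the restriction
    [a /\ eta]; frame distributivity makes this exact, not only for generators.
    Given [a_x] in [mu], pronormality of [eta] yields [b_y] in
    [<eta, eta^{a_x}>], hence in [<N(eta), N(eta)^{a_x}>], with
    [eta^{b_y} = eta^{a_x}].  Evaluating at the identity, where [eta] takes the
    value [tip mu], gives [b = a].  Then [a_(x y^-1)] lies in [N(eta)], so
    conjugation by [x y^-1] preserves [N(eta)] up to level [a], and the same
    [a_y] witnesses [N(eta)^{a_y} = N(eta)^{a_x}]. *)
Require Import Defs.
From mathcomp Require Import all_boot all_order monoid.
From mathcomp Require Import all_classical.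

Set Implicit Arguments.
Unset Strict Implicit.
Unset Printing Implicit Defensive.

Import Order.TTheory.

Local Open Scope classical_set_scope.
Local Open Scope order_scope.
Local Open Scope group_scope.

Section Normalizer.
Context (d : Order.disp_t) (L : tbLatticeType d).
Context (cL : complete_lattice L).

Lemma lsup_ub (A : set L) a : A a -> a <= lsup A.
Proof. by move=> Aa; apply: (lsupP A cL).1. Qed.

Lemma lsup_le (A : set L) u : (forall a, A a -> a <= u) -> lsup A <= u.
Proof. by move=> Au; apply: (lsupP A cL).2. Qed.

(** Frame distributivity is complete distributivity for the two-member family [[set a]], [A] indexed
    by [bool]: a choice function takes [a] at [true] and some element of [A] at [false]. *)
Lemma meet_lsup_le (A : set L) a u : completely_distributive L ->
  (forall b, A b -> a `&` b <= u) -> a `&` lsup A <= u.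
Proof.
move=> dL Au; pose J (i : bool) := if i then [set a] else A.
have : a `&` lsup A <= linf (range (fun i => lsup (J i))).
  apply: (linfP _ cL).2 => _ [[] _ <-] /=; last exact: leIr.
  by apply: le_trans (leIl _ _) _; exact: lsup_ub.
move=> /le_trans; apply; rewrite dL; apply: lsup_le => _ [f Jf <-].
have fa : f true = a by exact: (Jf true).
apply: le_trans (Au _ (Jf false)); rewrite -fa lexI.
by apply/andP; split; apply: (linfP _ cL).1; [exists true | exists false].
Qed.

Context (G : groupType).
Implicit Types (mu eta nu : G -> L) (a c : L) (x y w : G).

Lemma lsubgroup_le1 mu x : lsubgroup mu -> mu x <= mu 1.
Proof. by move=> [muM muV]; have := muM x x^-1; rewrite muV meetxx mulgV. Qed.

Lemma tip1 mu : lsubgroup mu -> tip mu = mu 1.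
Proof.
move=> gmu; apply/eqP; rewrite eq_le; apply/andP; split.
  by apply: lsup_le => _ [x _ <-]; exact: lsubgroup_le1.
by apply: lsup_ub; exists 1.
Qed.

Lemma lsubgroup_conj mu a x w : lsubgroup mu -> a <= mu x ->
  a `&` mu w <= mu (x * w * x^-1).
Proof.
move=> [muM muV] ax; apply: le_trans (muM _ _); rewrite muV lexI.
rewrite (le_trans (leIl _ _) ax) andbT.
by apply: le_trans (muM _ _); exact: leI2.
Qed.

(** The missing inequality is [lsubgroup_conj] for [x^-1], applied to the conjugate itself. *)
Lemma lsubgroup_conjE mu a x w : lsubgroup mu -> a <= mu x ->
  a `&` mu (x * w * x^-1) = a `&` mu w.
Proof.
move=> gmu ax; apply/eqP; rewrite eq_le !lexI !leIl /= lsubgroup_conj // andbT.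
have ax' : a <= mu x^-1 by rewrite gmu.2.
have := lsubgroup_conj (x * w * x^-1) gmu ax'.
by rewrite invgK !mulgA mulVg mul1g mulgVK.
Qed.

Lemma lconj_sub mu eta a x : lsubgroup mu -> lsubset eta mu -> a <= mu x ->
  lsubset (lconj eta a x) mu.
Proof.
move=> gmu se ax w; apply: le_trans (leI2 (lexx a) (se _)) _.
by rewrite lsubgroup_conjE // leIr.
Qed.

Lemma lgen_sub nu eta theta : lsubgroup nu ->
  lsubset eta nu -> lsubset theta nu -> lsubset (lgen (lunion eta theta)) nu.
Proof.
move=> gnu en tn; have [_ _] := lgen_least (lunion eta theta) cL; apply=> // x.
by rewrite /lunion leUx en tn.
Qed.

Lemma lgen_mono eta eta' theta theta' : lsubset eta eta' ->
  lsubset theta theta' ->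
  lsubset (lgen (lunion eta theta)) (lgen (lunion eta' theta')).
Proof.
move=> ee tt; have [g s _] := lgen_least (lunion eta' theta') cL.
by apply: lgen_sub => // x; apply: le_trans (s x);
  [apply: le_trans (ee x) (leUl _ _) | apply: le_trans (tt x) (leUr _ _)].
Qed.

(** The substitution [z = x * w] turns the coset equation into one about conjugates. *)
Lemma coset_eqP eta a x : left_coset a x eta = right_coset eta a x <->
  forall w, a `&` eta (x * w * x^-1) = a `&` eta w.
Proof.
split=> [e w|e]; last apply/funext => z.
  by have := congr1 (@^~ (x * w)) e; rewrite /left_coset /right_coset mulKg.
by rewrite /left_coset /right_coset -e mulgA mulgV mul1g.
Qed.

Context (dL : completely_distributive L).

Lemma le_normalizerP mu eta c x : c <= normalizer mu eta x <->
  c <= mu x /\ forall w, c `&` eta (x * w * x^-1) = c `&` eta w.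
Proof.
split=> [cN|[cx ce]]; last first.
  apply: lsup_ub; exists (lpoint c x); last by rewrite /lpoint eqxx.
  by exists c, x; split=> //; apply/coset_eqP.
(* Upper bounds on a meet with the normalizer can be tested on generators; those supported away from
   [x] contribute only [\bot]. *)
have Nle b u : (forall a, a <= mu x ->
    (forall w, a `&` eta (x * w * x^-1) = a `&` eta w) -> b `&` a <= u) ->
    b `&` normalizer mu eta x <= u.
  move=> hu; apply: meet_lsup_le => // _ [_ [a [y [-> ay /coset_eqP ey]]] <-].
  rewrite /lpoint; case: eqP => [xy|_]; last by rewrite meetx0 le0x.
  by apply: hu; rewrite xy.
split=> [|w].
  apply: le_trans cN _; rewrite -[X in X <= _]meet1x.
  by apply: Nle => a ax _; rewrite meet1x.
apply/eqP; rewrite eq_le !lexI !leIl /=.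
apply/andP; split; rewrite meetC.
  apply: le_trans (leI2 (lexx _) cN) _; apply: Nle => a _ ae.
  by rewrite meetC ae leIr.
apply: le_trans (leI2 (lexx _) cN) _; apply: Nle => a _ ae.
by rewrite meetC -ae leIr.
Qed.

Lemma normalizer_lsubgroup mu eta : lsubgroup mu ->
  lsubgroup (normalizer mu eta).
Proof.
move=> [muM muV].
have NP x := (le_normalizerP mu eta _ x).1 (lexx _).
split=> [x y|].
  have [[ax ex] [ay ey]] := (NP x, NP y).
  apply/le_normalizerP; split=> [|w]; first exact: le_trans (leI2 ax ay) (muM _ _).
  (* Conjugation by the product is done in two stages, each absorbed at its own level. *)
  have -> : x * y * w * (x * y)^-1 = x * (y * w * y^-1) * x^-1.
    by rewrite invgM !mulgA.
  by rewrite meetAC ex meetAC -meetA ey meetA.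
have NV x : normalizer mu eta x <= normalizer mu eta x^-1.
  have [ax ex] := NP x; apply/le_normalizerP; split=> [|w]; first by rewrite muV.
  by rewrite -ex invgK !mulgA mulgV mul1g mulgK.
by move=> x; apply/eqP; rewrite eq_le NV -{2}[x]invgK NV.
Qed.

Lemma normalizer_sub mu eta : lsubset (normalizer mu eta) mu.
Proof. by move=> x; have [] := (le_normalizerP mu eta _ x).1 (lexx _). Qed.

Lemma sub_normalizer mu eta : lsubgroup_of mu eta ->
  lsubset eta (normalizer mu eta).
Proof.
move=> [ge se] x; apply/le_normalizerP; split=> // w.
exact: lsubgroup_conjE.
Qed.

Lemma normalizer_pronormal mu eta : lsubgroup mu -> pronormal mu eta ->
  tip eta = tip mu -> pronormal mu (normalizer mu eta).
Proof.
move=> gmu [he pe] tE; have [ge se] := he.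
have gN := normalizer_lsubgroup eta gmu; have sN := sub_normalizer he.
split=> [|a x ax]; first by split=> //; exact: normalizer_sub.
have [b [y [by_in eby]]] := pe a x ax.
have conjE w : b `&` eta (y * w * y^-1) = a `&` eta (x * w * x^-1).
  by have := congr1 (@^~ w) eby.
have by_mu : b <= mu y.
  by apply: le_trans by_in _; apply: lgen_sub => //; exact: lconj_sub.
(* The tip hypothesis enters here: [eta 1 = mu 1] bounds every value of [mu]. *)
have le_eta1 c z : c <= mu z -> c `&` eta 1 = c.
  move=> cz; apply/meet_idPl; rewrite -tip1 // tE tip1 //.
  by apply: le_trans cz _; exact: lsubgroup_le1.
have ba : b = a.
  by have := conjE 1; rewrite !mulg1 !mulgV (le_eta1 _ y) // (le_eta1 _ x).
subst b; exists a, y; split.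
  (* Since [eta] lies in its normalizer, the conjugate of [eta] lies in that of the normalizer. *)
  apply: le_trans by_in _; apply: lgen_mono => // w.
  exact: leI2.
have aN : a <= normalizer mu eta (x * y^-1).
  apply/le_normalizerP; split=> [|w].
    by apply: le_trans (gmu.1 _ _); rewrite gmu.2 lexI ax.
  (* This argument cancels the conjugation by [y] and leaves [x * y^-1] acting on [w]. *)
  have := conjE (y^-1 * w * y).
  by rewrite invgM invgK !mulgA mulgV mul1g mulgK => ->.
(* Conjugating [y * w * y^-1] by [x * y^-1] gives [x * w * x^-1], at no cost below level [a]. *)
apply/funext => w; rewrite /lconj -(lsubgroup_conjE _ gN aN).
by rewrite invgM invgK !mulgA !mulgVK.
Qed.

End Normalizer.

Theorem theorem4p6 (d : Order.disp_t) (L : tbLatticeType d)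
    (hcomplete : complete_lattice L) (hdistr : completely_distributive L)
    (G : groupType) (mu : G -> L) (hmu : lsubgroup mu)
    (eta : G -> L) (heta : pronormal mu eta) (htip : tip eta = tip mu) :
  pronormal mu (normalizer mu eta).
Proof. exact: normalizer_pronormal. Qed.
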